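(* For each $M \in \{18, 22, 24, 25, 26, 30, 36, 37, 38, 45, 46, 54, 60, 62, 73, 90, 105, 122, 126\}$, the equivalence class of Rule $M$ is not vN-regular; that is, no elementary cellular automaton equivalent to Rule $M$ is a vN-regular element of $\mathrm{CA}(\mathbb{Z};\{0,1\})$.
   Context: Let $A=\{0,1\}$. Functions are applied on the right, and $\tau\sigma$ means first $\tau$, then $\sigma$. A cellular automaton over $A^{\mathbb{Z}}$ is a map $\tau:A^{\mathbb{Z}}\to A^{\mathbb{Z}}$ for which there exist a finite $S\subseteq\mathbb{Z}$ (memory set) and $\mu:A^S\to A$ (local function) such that for all $x\in A^{\mathbb{Z}}$, $i\in\mathbb{Z}$, $(i)(x)\tau$ is the value of $\mu$ at the map $s\mapsto (s+i)x$ on $S$. $\mathrm{CA}(\mathbb{Z};A)$ is the monoid of all cellular automata over $A^{\mathbb{Z}}$ under composition. $\tau\in\mathrm{CA}(\mathbb{Z};A)$ is vN-regular if there exists $\sigma\in\mathrm{CA}(\mathbb{Z};A)$ (not necessarily elementary) with $\tau\sigma\tau=\tau$. An elementary cellular automaton is one with memory set $\{-1,0,1\}$. Rule $M$ ($0\leq M\leq 255$) is the elementary cellular automaton whose local function $\mu_M$ is defined as follows: let $M_1\dots M_8$ be the 8-bit binary representation of $M$ (most significant bit first) and list the elements of $A^{\{-1,0,1\}}$, written as words $(-1)x\,(0)x\,(1)x$, in lexicographically descending order $111,110,\dots,000$; then $\mu_M$ sends the $i$-th element to $M_i$. $\phi_{51}$ denotes Rule 51, which interchanges $0$'s and $1$'s;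 $\langle\phi_{51}\rangle=\{\mathrm{id},\phi_{51}\}$. For $x\in A^{\mathbb{Z}}$, $(k)x^{\mathrm{rev}}:=(-k)x$, and $(x)\tau^\star:=((x^{\mathrm{rev}})\tau)^{\mathrm{rev}}$. Two elementary cellular automata $\tau_1,\tau_2$ are equivalent if $\tau_1\in\langle\phi_{51}\rangle\tau_2\langle\phi_{51}\rangle$ or $\tau_1\in\langle\phi_{51}\rangle(\tau_2)^\star\langle\phi_{51}\rangle$. *)

(* Defs.v *)
From mathcomp Require Export all_boot all_order all_algebra.
From mathcomp Require Export finmap.

Set Implicit Arguments.
Unset Strict Implicit.
Unset Printing Implicit Defensive.

Import GRing.Theory.

Local Open Scope fset_scope.
Local Open Scope ring_scope.

Definition config : Type := int -> bool.

(* Maps are written on the right of their arguments, as in x |-> (x) t: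
   accordingly, products of maps are [t \; s], i.e. first t, then s.
   Maps and configurations are compared with Leibniz equality, to be understood
   with functional extensionality. *)

Definition has_local_function (t : config -> config)
    (S : {fset int}) (mu : {ffun S -> bool} -> bool) : Prop :=
  forall (x : config) (i : int), t x i = mu [ffun s : S => x (val s + i)].

Definition has_memory_set (t : config -> config) (S : {fset int}) : Prop :=
  exists mu : {ffun S -> bool} -> bool, has_local_function t mu.

Definition cellular_automaton (t : config -> config) : Prop :=
  exists S : {fset int}, has_memory_set t S.

Definition vN_regular (t : config -> config) : Prop :=
  exists s : config -> config,
    cellular_automaton s /\ t \; s \; t = t.

Definition nbhd3 : {fset int} := [fset -1; 0; 1].

Definition elementary (t : config -> config) : Prop := has_memory_set t nbhd3.

Fact left_in_nbhd3 : (-1 : int) \in nbhd3. Proof. by rewrite !inE. Qed.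
Fact center_in_nbhd3 : (0 : int) \in nbhd3. Proof. by rewrite !inE. Qed.
Fact right_in_nbhd3 : (1 : int) \in nbhd3. Proof. by rewrite !inE. Qed.

Definition word_of (p : {ffun nbhd3 -> bool}) : seq bool :=
  [:: p [` left_in_nbhd3]; p [` center_in_nbhd3]; p [` right_in_nbhd3]].

Definition words3 : seq (seq bool) :=
  [:: [:: true; true; true];   [:: true; true; false];
      [:: true; false; true];  [:: true; false; false];
      [:: false; true; true];  [:: false; true; false];
      [:: false; false; true]; [:: false; false; false]].

(* Most significant bit first. *)
Definition binary8 (M : nat) : seq bool :=
  [seq odd (M %/ 2 ^ (7 - k)) | k <- iota 0 8].

Definition rule_local (M : nat) (p : {ffun nbhd3 -> bool}) : bool :=
  nth false (binary8 M) (index (word_of p) words3).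

Definition rule (M : nat) (x : config) : config :=
  fun i => rule_local M [ffun s : nbhd3 => x (val s + i)].

Definition rev_config (x : config) : config := fun k => x (- k).

Definition star (t : config -> config) : config -> config :=
  fun x => rev_config (t (rev_config x)).

(* The subgroup generated by Rule 51, which is an involution. *)
Definition in_gen51 (g : config -> config) : Prop := g = id \/ g = rule 51.

Definition in_double_coset51 (t1 t2 : config -> config) : Prop :=
  exists g h : config -> config,
    [/\ in_gen51 g, in_gen51 h & t1 = g \; t2 \; h].

Definition eca_equivalent (t1 t2 : config -> config) : Prop :=
  in_double_coset51 t1 t2 \/ in_double_coset51 t1 (star t2).

(* Main.v *)
(** A cellular automaton commutes with translations.  Hence if [t \; s \; t = t]
    and [t x] is [k]-periodic, then [s (t x)] is a [k]-periodic preimage of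
    [t x]: a regular automaton lifts periods.  Lifting periods is invariant
    under the equivalence of elementary automata, and every rule of the list
    fails it for a period at most 3. *)
Require Import Defs.
From Stdlib Require Import FunctionalExtensionality.

Set Implicit Arguments.
Unset Strict Implicit.
Unset Printing Implicit Defensive.

Import Order.TTheory GRing.Theory Num.Theory.

Local Open Scope ring_scope.

Definition shift (k : int) (x : config) : config := fun i => x (i + k).

Lemma ca_shift (s : config -> config) (k : int) (x : config) :
  cellular_automaton s -> s (shift k x) = shift k (s x).
Proof.
move=> [S [mu smu]]; apply: functional_extensionality => i.
rewrite /shift !smu; congr mu; apply/ffunP => j.
by rewrite !ffunE addrA.
Qed.

Definition lifts_periods (t : config -> config) : Prop :=
  forall (x : config) (k : int), shift k (t x) = t x ->
    exists2 y, shift k y = y & t y = t x.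

Lemma vN_regular_lifts_periods (t : config -> config) :
  vN_regular t -> lifts_periods t.
Proof.
move=> [s [s_ca tst]] x k txk; exists (s (t x)).
  by rewrite -ca_shift // txk.
exact: (congr1 (fun f => f x) tst).
Qed.

Lemma ruleE (M : nat) (x : config) (i : int) :
  rule M x i =
    nth false (binary8 M) (index [:: x (-1 + i); x i; x (1 + i)] words3).
Proof. by rewrite /rule /rule_local /word_of !ffunE /= add0r. Qed.

Lemma rule_shift (M : nat) (k : int) (x : config) :
  rule M (shift k x) = shift k (rule M x).
Proof.
by apply: functional_extensionality => i; rewrite /shift !ruleE !addrA.
Qed.

Lemma rule51E (x : config) (i : int) : rule 51 x i = ~~ x i.
Proof. by rewrite ruleE; case: (x (-1 + i)) (x i) (x (1 + i)) => [] [] []. Qed.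

Lemma in_gen51_involutive (g : config -> config) : in_gen51 g -> involutive g.
Proof.
by case=> -> // x; apply: functional_extensionality => i; rewrite !rule51E negbK.
Qed.

Lemma in_gen51_shift (g : config -> config) (k : int) (x : config) :
  in_gen51 g -> g (shift k x) = shift k (g x).
Proof. by case=> -> //; rewrite rule_shift. Qed.

(** Both [g] and [h] are involutions and [g] commutes with shifts. Lifting for [t1] at [g x] gives a
    periodic [y]; cancelling [h] shows that [g y], still periodic, is the preimage wanted for
    [t2]. *)
Lemma double_coset51_lifts_periods (t1 t2 : config -> config) :
  in_double_coset51 t1 t2 -> lifts_periods t1 -> lifts_periods t2.
Proof.
move=> [g [h [g51 h51 ->]]] lift1 x k t2xk.
have [|y yk] := lift1 (g x) k; rewrite /= !(in_gen51_involutive g51).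
  by rewrite -in_gen51_shift ?t2xk.
move=> /(inv_inj (in_gen51_involutive h51)) t2gy.
by exists (g y); rewrite // -in_gen51_shift ?yk.
Qed.

Lemma rev_configK : involutive rev_config.
Proof.
by move=> x; apply: functional_extensionality => i; rewrite /rev_config opprK.
Qed.

Lemma rev_config_shift (k : int) (x : config) :
  rev_config (shift k x) = shift (- k) (rev_config x).
Proof.
by apply: functional_extensionality => i; rewrite /rev_config /shift opprD opprK.
Qed.

(** Reversal turns a shift by [k] into a shift by [- k]; this is why [lifts_periods] quantifies over
    integer periods of either sign. *)
Lemma star_lifts_periods (t : config -> config) :
  lifts_periods (star t) -> lifts_periods t.
Proof.
move=> lift x k txk.
have [|y yk] := lift (rev_config x) (- k); rewrite /star rev_configK.
  by rewrite -rev_config_shift txk.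
move=> /(inv_inj rev_configK) tyx.
by exists (rev_config y); rewrite // -[k]opprK -rev_config_shift yk.
Qed.

Definition cyc (w : seq bool) : config :=
  fun i => nth false w `|(i %% (size w)%:Z)%Z|%N.

Lemma modz_nat_ind (n : nat) (P : int -> Prop) : (0 < n)%N ->
  (forall i, P (i %% n%:Z)%Z -> P i) ->
  (forall j : nat, (j < n)%N -> P j%:Z) -> forall i, P i.
Proof.
move=> n_gt0 Pmod Pn i; apply: Pmod.
have n_neq0 : n%:Z != 0 by rewrite eqz_nat -lt0n.
rewrite -[(i %% _)%Z]gez0_abs ?modz_ge0 //; apply: Pn.
by rewrite -ltz_nat gez0_abs ?modz_ge0 // ltz_pmod.
Qed.

Lemma cyc_mod (w : seq bool) (k i : int) :
  cyc w (k + (i %% (size w)%:Z)%Z) = cyc w (k + i).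
Proof. by rewrite /cyc modzDmr. Qed.

Lemma rule_cyc_mod (M : nat) (w : seq bool) (k i : int) :
  rule M (cyc w) (k + (i %% (size w)%:Z)%Z) = rule M (cyc w) (k + i).
Proof. by rewrite !ruleE ![_ + (k + _)]addrA !cyc_mod. Qed.

(** This makes the search for an [n]-periodic preimage finite: only the words of length [n] have to
    be tried. *)
Lemma periodic_cyc (y : config) (n : nat) : (0 < n)%N ->
  shift n%:Z y = y -> y = cyc (mkseq (fun j => y j%:Z) n).
Proof.
move=> n_gt0 yn.
have ynE i : y (i + n%:Z) = y i by rewrite -[in RHS]yn.
have ynat i (m : nat) : y (i + m%:Z * n%:Z) = y i.
  elim: m => [|m IHm]; first by rewrite mul0r addr0.
  by rewrite -addn1 PoszD mulrDl mul1r addrA ynE.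
have yint i (q : int) : y (i + q * n%:Z) = y i.
  (* A negative multiple is undone by the natural case applied at the translated point. *)
  by case: q => m; rewrite ?ynat // NegzE mulNr -(ynat _ m.+1) subrK.
apply: functional_extensionality => i; rewrite /cyc size_mkseq.
have n_neq0 : n%:Z != 0 by rewrite eqz_nat -lt0n.
rewrite nth_mkseq; last by rewrite -ltz_nat gez0_abs ?modz_ge0 // ltz_pmod.
rewrite gez0_abs ?modz_ge0 // [in LHS](divz_eq i n%:Z) addrC.
exact: yint.
Qed.

Fixpoint bool_words (n : nat) : seq (seq bool) :=
  if n is m.+1 then [seq b :: v | b <- [:: true; false], v <- bool_words m]
  else [:: [::]].

Lemma mem_bool_words (v : seq bool) : v \in bool_words (size v).
Proof.
elim: v => [|b v IHv] //; apply/allpairsP.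
by exists (b, v); split=> //=; case: b.
Qed.

(* [rule] evaluated through [ruleE], because finite functions do not compute. *)
Definition eca (M : nat) (x : config) (i : int) : bool :=
  nth false (binary8 M) (index [:: x (-1 + i); x i; x (1 + i)] words3).

(** A computable certificate that [cyc w] refutes the lifting of period [p]. One period of [w]
    suffices to test the periodicity of the image; a disagreement found there already rules out a
    candidate preimage. *)
Definition unlifted (M p : nat) (w : seq bool) : bool :=
  [&& (0 < p)%N, (0 < size w)%N,
      all (fun i : nat => eca M (cyc w) (p%:Z + i%:Z) == eca M (cyc w) i%:Z)
          (iota 0 (size w)) &
      all (fun v => has (fun i : nat => eca M (cyc v) i%:Z != eca M (cyc w) i%:Z)
                        (iota 0 (size w)))
          (bool_words p)].

Lemma unlifted_not_lifts_periods (M p : nat) (w : seq bool) :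
  unlifted M p w -> ~ lifts_periods (rule M).
Proof.
move=> /and4P[p_gt0 w_gt0 /allP wp /allP no_v] lift.
have [|y yp Ry] := lift (cyc w) p%:Z.
  apply: functional_extensionality => i; rewrite /shift addrC.
  move: i; apply: (modz_nat_ind w_gt0) => [i|j ltj].
    by rewrite rule_cyc_mod -[(i %% _)%Z]add0r rule_cyc_mod add0r.
  by rewrite !ruleE; apply/eqP/wp; rewrite mem_iota.
(* One period of the lifted preimage [y] is among the words that the certificate excludes. *)
set v := mkseq (fun j => y j%:Z) p.
have v_word : v \in bool_words p.
  by rewrite -[p in bool_words p](size_mkseq (fun j => y j%:Z)) mem_bool_words.
have /hasP[i _ /eqP[]] := no_v v v_word.
by rewrite /eca -!ruleE -periodic_cyc // Ry.
Qed.

Local Close Scope ring_scope.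

(* The entries (M, (p, w)) were found by computer search. *)
Definition witnesses : seq (nat * (nat * seq nat)) :=
  [:: (18, (2, [:: 0; 0; 0; 1]));    (22, (1, [:: 0; 0; 1]));
      (24, (2, [:: 0; 0; 1; 1]));    (25, (2, [:: 0; 0; 1; 1]));
      (26, (2, [:: 0; 0; 0; 1]));    (30, (1, [:: 0; 0; 1]));
      (36, (1, [:: 0; 1]));          (37, (2, [:: 0; 0; 0; 1]));
      (38, (1, [:: 0; 1]));          (45, (2, [:: 0; 0; 0; 1]));
      (46, (1, [:: 0; 1]));          (54, (1, [:: 0; 1]));
      (60, (1, [:: 0; 1]));          (62, (1, [:: 0; 1]));
      (73, (2, [:: 0; 1; 1; 1]));    (90, (1, [:: 0; 0; 1; 1]));
      (105, (3, [:: 0; 0; 0; 0; 1; 1])); (122, (1, [:: 0; 1; 1]));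
      (126, (1, [:: 0; 1]))].

(** For instance, Rule 60 adds the left and centre cells modulo 2: it sends the alternating
    configuration to the constant 1, whereas both constant configurations go to 0. *)
Lemma witnesses_unlifted :
  all (fun c => unlifted c.1 c.2.1 [seq odd b | b <- c.2.2]) witnesses.
Proof. by vm_compute. Qed.

Theorem lemma2 (M : nat)
    (hM : M \in [:: 18; 22; 24; 25; 26; 30; 36; 37; 38; 45; 46; 54; 60; 62;
                    73; 90; 105; 122; 126])
    (t : config -> config)
    (ht : elementary t)
    (hequiv : eca_equivalent t (rule M)) :
  ~ vN_regular t.
Proof.
move=> /vN_regular_lifts_periods lift_t.
(* The first components of [witnesses] compute to the list in [hM]. *)
have /mapP[c c_wit defM] : M \in [seq c.1 | c <- witnesses] by [].
apply: (unlifted_not_lifts_periods (allP witnesses_unlifted c c_wit)).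
rewrite -defM; case: hequiv => tM.
  exact: double_coset51_lifts_periods tM lift_t.
exact/star_lifts_periods/(double_coset51_lifts_periods tM).
Qed.
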